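(* Let $p>2$ be a prime, $\mathbf{F}$ a field of characteristic $p$, and $W$ a finite subgroup of $(\mathbf{F},+)$ of order $p^r$. Let $c\in W$ act on $\mathbf{F}[V_3]=\mathbf{F}[x,y,z]$ by the algebra automorphism with $x\cdot c=x$, $y\cdot c=y+cx$, $z\cdot c=z+2cy+c^2x$. Let $\delta=y^2-xz$, $N_W(y)=\prod_{c\in W}(y+cx)$, $N_W(z)=\prod_{c\in W}(z+2cy+c^2x)$. Let $H_W(s,t)\in\mathbf{F}[s,t]$ be the polynomial with $H_W(x,y^2)=N_W(y)^2-y^{2p^r}$. Then $\mathbf{F}[V_3]^W$ is the hypersurface generated by $\{x,\delta,N_W(y),N_W(z)\}$ subject to the relation $$\delta^{p^r}-N_W(y)^2+x^{p^r}N_W(z)+H_W(x,\delta)=0$$ (i.e. these four elements generate the invariant ring and the ideal of algebraic relations among them is generated by this relation). Furthermore, this generating set is a SAGBI basis for $\mathbf{F}[V_3]^W$ with respect to the graded reverse lexicographic order with $z>y>x$.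
   Context: $V_3$ is the dual of the symmetric square of $V_2^*$, where $V_2$ is the two-dimensional representation $c\mapsto\begin{pmatrix}1&c\\0&1\end{pmatrix}$ of $W$. The polynomial $N_W(y)^2-y^{2p^r}$ is a polynomial in $x$ and $y^2$ (the polynomial $N_W(y)$ involves only monomials $y^{p^i}x^{p^r-p^i}$, $0\le i\le r$, and $p$ is odd), so $H_W$ is well defined. A subset $\mathcal{B}$ of a subalgebra $A$ of a polynomial ring is a SAGBI basis for $A$ if the lead monomials of the elements of $\mathcal{B}$ generate, as an algebra, the lead term algebra of $A$ (the algebra spanned by the lead monomials of the nonzero elements of $A$). *)

(* Defs.v *)
From mathcomp Require Import all_boot all_order all_algebra.
From mathcomp Require Import finmap.
From mathcomp Require Export mpoly.

Set Implicit Arguments.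
Unset Strict Implicit.
Unset Printing Implicit Defensive.

Import GRing.Theory.

Local Open Scope ring_scope.

Section Sagbi.

Variables (n : nat) (F : fieldType).
Implicit Types (f : {mpoly F[n]}) (S A B : {mpoly F[n]} -> Prop).

(* Graded reverse lexicographic order with 'X_(n-1) > ... > 'X_1 > 'X_0: in
   equal degree, m1 < m2 when m1 has the larger exponent at the smallest
   variable (the least index) at which they differ. The order mnmc_le of mpoly
   is the graded lexicographic one, so mlead is not the lead monomial here. *)
Definition grevlex_lt (m1 m2 : 'X_{1..n}) : bool :=
  (mdeg m1 < mdeg m2)%N ||
  (mdeg m1 == mdeg m2) &&
  [exists i : 'I_n,
     (m2 i < m1 i)%N && [forall j : 'I_n, (j < i)%N ==> (m1 j == m2 j)]].

(* Never holds for f = 0, whose support is empty. *)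
Definition is_lead_mon f (m : 'X_{1..n}) : Prop :=
  m \in msupp f /\
  forall m', m' \in msupp f -> m' != m -> grevlex_lt m' m.

Definition lead_mons S : {mpoly F[n]} -> Prop :=
  fun u => exists f m, [/\ S f, is_lead_mon f m & u = 'X_[m]].

Definition lin_span S : {mpoly F[n]} -> Prop :=
  fun f => exists s : seq (F * {mpoly F[n]}),
    (forall au, au \in s -> S au.2) /\ f = \sum_(au <- s) au.1 *: au.2.

Definition subalg_gen S : {mpoly F[n]} -> Prop :=
  fun f => exists k (g : k.-tuple {mpoly F[n]}) (P : {mpoly F[k]}),
    (forall i, S (tnth g i)) /\ f = P \mPo g.

Definition lead_term_algebra A : {mpoly F[n]} -> Prop := lin_span (lead_mons A).

Definition is_sagbi_basis B A : Prop :=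
  (forall f, B f -> A f) /\
  (forall f, subalg_gen (lead_mons B) f <-> lead_term_algebra A f).

End Sagbi.

Section SymmetricSquare.

Variable F : fieldType.

Definition vx : {mpoly F[3]} := 'X_(@Ordinal 3 0 isT).
Definition vy : {mpoly F[3]} := 'X_(@Ordinal 3 1 isT).
Definition vz : {mpoly F[3]} := 'X_(@Ordinal 3 2 isT).

Definition y_act (c : F) : {mpoly F[3]} := vy + c *: vx.
Definition z_act (c : F) : {mpoly F[3]} :=
  vz + (2%:R * c) *: vy + (c ^+ 2) *: vx.

Definition W_act (c : F) (f : {mpoly F[3]}) : {mpoly F[3]} :=
  f \mPo [tuple vx; y_act c; z_act c].

Definition W_invariant (W : {fset F}) (f : {mpoly F[3]}) : Prop :=
  forall c, c \in W -> W_act c f = f.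

Definition delta : {mpoly F[3]} := vy ^+ 2 - vx * vz.

Definition Ny (W : {fset F}) : {mpoly F[3]} := \prod_(c <- W) y_act c.
Definition Nz (W : {fset F}) : {mpoly F[3]} := \prod_(c <- W) z_act c.

Definition gens (W : {fset F}) : 4.-tuple {mpoly F[3]} :=
  [tuple vx; delta; Ny W; Nz W].

(* q stands for the order of W. *)
Definition HW_spec (W : {fset F}) (q : nat) (H : {mpoly F[2]}) : Prop :=
  H \mPo [tuple vx; vy ^+ 2] = Ny W ^+ 2 - vy ^+ (2 * q).

(* Presentation variables T0, T1, T2, T3 stand for x, delta, N_W(y), N_W(z). *)
Definition T0 : {mpoly F[4]} := 'X_(@Ordinal 4 0 isT).
Definition T1 : {mpoly F[4]} := 'X_(@Ordinal 4 1 isT).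
Definition T2 : {mpoly F[4]} := 'X_(@Ordinal 4 2 isT).
Definition T3 : {mpoly F[4]} := 'X_(@Ordinal 4 3 isT).

Definition hsurf_relation (q : nat) (H : {mpoly F[2]}) : {mpoly F[4]} :=
  T1 ^+ q - T2 ^+ 2 + T0 ^+ q * T3 + (H \mPo [tuple T0; T1]).

End SymmetricSquare.

(* Main.v *)
(* Write q for the order of W, which is odd. Invariance of N_W(y) under W shows
   that prod_c ((y + c x)^2 - s) = N_W(y)^2 - prod_c (s - c^2 x^2) for every s;
   s = delta gives the relation, with H_W(x, s) = prod_c (s - c^2 x^2) - s^q.
   The lead monomials of the generators are x, y^2, y^q, z^q, so, q being odd,
   the monomials x^a delta^b N_W(y)^e N_W(z)^d with e <= 1 have pairwise distinct
   lead monomials. The relation reduces every polynomial in the generators to a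
   combination of such monomials; this determines the ideal of relations and the
   lead monomials, and it shows that an element of the generated algebra A which
   is divisible by x is x times an element of A. It remains to see that every
   homogeneous invariant f lies in A[1/x]. Eliminating z = (y^2 - delta) / x turns
   f into a polynomial in y over F[x, 1/x, delta] that is invariant under
   y |-> y + c x, hence a polynomial in N_W(y). *)
From HB Require Import structures.
Require Import Defs.
From mathcomp Require Import all_boot all_order all_algebra.
From mathcomp Require Import finmap mpoly.
From mathcomp Require Import ring.

Set Implicit Arguments.
Unset Strict Implicit.
Unset Printing Implicit Defensive.

Import GRing.Theory.

Local Open Scope ring_scope.

(** * The graded reverse lexicographic order and lead monomials *)

Section GrevlexOrder.

Variable n : nat.
Implicit Types (m : 'X_{1..n}).

Lemma grevlex_ltP m1 m2 :
  reflect ((mdeg m1 < mdeg m2)%N \/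
           mdeg m1 = mdeg m2 /\
           exists2 i : 'I_n, (m2 i < m1 i)%N &
             forall j : 'I_n, (j < i)%N -> m1 j = m2 j)
          (grevlex_lt m1 m2).
Proof.
apply: (iffP orP) => [[|/andP[/eqP e /existsP[i /andP[lti /forallP h]]]]|].
- by left.
- right; split=> //; exists i => // j ltji.
  by apply/eqP; apply: (implyP (h j)).
case=> [|[e [i lti h]]]; [by left|right].
rewrite e eqxx; apply/existsP; exists i; rewrite lti /=.
by apply/forallP => j; apply/implyP => /h ->.
Qed.

Lemma grevlex_ltnn m : grevlex_lt m m = false.
Proof. by apply/grevlex_ltP => -[|[_ [i]]]; rewrite ltnn. Qed.

Lemma grevlex_lt_trans m2 m1 m3 :
  grevlex_lt m1 m2 -> grevlex_lt m2 m3 -> grevlex_lt m1 m3.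
Proof.
move=> /grevlex_ltP h12 /grevlex_ltP h23; apply/grevlex_ltP.
case: h12 => [lt12|[e12 [i lti hi]]]; case: h23 => [lt23|[e23 [j ltj hj]]].
- by left; apply: ltn_trans lt23.
- by left; rewrite -e23.
- by left; rewrite e12.
right; split; first by rewrite e12.
case: (ltngtP i j) => [ltij|ltji|/val_inj eij].
- by exists i => [|k ltki]; [rewrite -hj | rewrite hi ?hj // (ltn_trans ltki)].
- by exists j => [|k ltkj]; [rewrite hi | rewrite hi ?hj // (ltn_trans ltkj)].
rewrite eij in lti hi *; exists j => [|k ltk]; last by rewrite hi ?hj.
exact: ltn_trans lti.
Qed.

Lemma grevlex_total m1 m2 :
  m1 != m2 -> grevlex_lt m1 m2 \/ grevlex_lt m2 m1.
Proof.
move=> neq; case: (ltngtP (mdeg m1) (mdeg m2)) => [lt|lt|e].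
- by left; apply/grevlex_ltP; left.
- by right; apply/grevlex_ltP; left.
have [i neqi] : exists i : 'I_n, m1 i != m2 i.
  apply/existsP; rewrite -negb_forall; apply: contraNN neq => /forallP h.
  by apply/eqP/mnmP => i; apply/eqP.
case: (@arg_minnP _ i (fun i => m1 i != m2 i) (fun i => i : nat) neqi) => j nej hj.
have eqk (k : 'I_n) : (k < j)%N -> m1 k = m2 k.
  by move=> ltkj; apply/eqP; apply: contraLR ltkj => /hj; rewrite -leqNgt.
case: (ltngtP (m1 j) (m2 j)) nej => // lt _; [right|left].
  by apply/grevlex_ltP; right; split=> //; exists j => // k /eqk.
by apply/grevlex_ltP; right; split=> //; exists j => // k /eqk.
Qed.

Lemma grevlex_lt_add2l m m1 m2 :
  grevlex_lt (m + m1) (m + m2) = grevlex_lt m1 m2.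
Proof.
rewrite /grevlex_lt !mdegD ltn_add2l eqn_add2l.
congr (_ || _ && _); apply: eq_existsb => i; rewrite !mnmDE ltn_add2l.
by congr (_ && _); apply: eq_forallb => j; rewrite !mnmDE eqn_add2l.
Qed.

Lemma grevlex_lt_add2r m m1 m2 :
  grevlex_lt (m1 + m) (m2 + m) = grevlex_lt m1 m2.
Proof. by rewrite ![(_ + m)%MM]addmC grevlex_lt_add2l. Qed.

End GrevlexOrder.

Section LeadMonomials.

Variables (n : nat) (F : fieldType).
Implicit Types (m : 'X_{1..n}) (f g : {mpoly F[n]}).

Lemma is_lead_mon_uniq f m m' : is_lead_mon f m -> is_lead_mon f m' -> m = m'.
Proof.
move=> [mf lem] [m'f lem']; apply/eqP/negP => /negP neq.
have := grevlex_lt_trans (lem' _ mf neq); rewrite eq_sym in neq.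
by move=> /(_ _ (lem _ m'f neq)); rewrite grevlex_ltnn.
Qed.

Lemma is_lead_monX m : is_lead_mon ('X_[m] : {mpoly F[n]}) m.
Proof. by rewrite /is_lead_mon msuppX; split=> [|m']; rewrite inE // => ->. Qed.

Lemma is_lead_monZ c f m : c != 0 -> is_lead_mon f m -> is_lead_mon (c *: f) m.
Proof.
move=> nzc [mf lem]; split=> [|m' /msuppZ_le]; last exact: lem.
by rewrite (perm_mem (msuppZ _ nzc)).
Qed.

Lemma is_lead_mon_addl f g m :
  is_lead_mon f m -> (forall m', m' \in msupp g -> grevlex_lt m' m) ->
  is_lead_mon (f + g) m.
Proof.
move=> [mf lem] ltm; split=> [|m' /msuppD_le].
  rewrite mcoeff_msupp mcoeffD (@memN_msupp_eq0 _ _ g) ?addr0 -?mcoeff_msupp //.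
  by apply/negP => /ltm; rewrite grevlex_ltnn.
by rewrite mem_cat => /orP[/lem|/ltm].
Qed.

Lemma is_lead_mon_below f m m' m0 :
  is_lead_mon f m -> grevlex_lt m m0 -> m' \in msupp f -> grevlex_lt m' m0.
Proof.
move=> [_ lem] lt /lem; case: eqVneq => [->//|_ /(_ isT) lt'].
exact: grevlex_lt_trans lt.
Qed.

(** The order is compatible with addition, so among the pairs of support monomials only [(m, m')]
    reaches the sum [m + m'], and a product of nonzero coefficients does not vanish. *)
Lemma is_lead_monM f g m m' :
  is_lead_mon f m -> is_lead_mon g m' -> is_lead_mon (f * g) (m + m')%MM.
Proof.
move=> [mf lem] [mg lem'].
have lt k k' : k \in msupp f -> k' \in msupp g -> (k, k') != (m, m') ->
    grevlex_lt (k + k')%MM (m + m')%MM.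
  move=> kf k'g; rewrite xpair_eqE negb_and.
  have [->|neq _] := eqVneq k m; first by rewrite grevlex_lt_add2l => /(lem' _ k'g).
  have lt1 : grevlex_lt (k + k')%MM (m + k')%MM.
    by rewrite grevlex_lt_add2r; apply: lem.
  have [->//|/(lem' _ k'g) lt2] := eqVneq k' m'.
    by rewrite grevlex_lt_add2r lem.
  by apply: grevlex_lt_trans lt1 _; rewrite grevlex_lt_add2l.
have split_lead (h : {mpoly F[n]}) k : h = h@_k *: 'X_[k] + (h - h@_k *: 'X_[k]).
  by rewrite addrC subrK.
have rem (h : {mpoly F[n]}) k k' : k' \in msupp (h - h@_k *: 'X_[k]) ->
    k' \in msupp h /\ k' != k.
  rewrite !mcoeff_msupp mcoeffB mcoeffZ mcoeffX; case: (eqVneq k k') => [->|].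
    by rewrite mulr1 subrr eqxx.
  by rewrite mulr0 subr0.
(* Peel off the lead term of [f], then that of [g]; both remainders contribute strictly smaller
   monomials. *)
rewrite (split_lead f m) mulrDl.
apply: is_lead_mon_addl; last first.
  move=> k /msuppM_le /allpairsP[[k1 k2] /= [/rem[k1f neq] k2g ->]].
  by apply: lt => //; apply: contraNneq neq => -[-> _].
rewrite (split_lead g m') mulrDr; apply: is_lead_mon_addl; last first.
  move=> k; rewrite -scalerAl => /msuppZ_le /msuppM_le /allpairsP[[k1 k2] /=].
  rewrite msuppX inE => -[/eqP-> /rem[k2g neq] ->].
  by apply: lt => //; apply: contraNneq neq => -[->].
rewrite -scalerAl -scalerAr -mpolyXD.
by do 2!(apply: is_lead_monZ; first by rewrite -mcoeff_msupp); apply: is_lead_monX.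
Qed.

Lemma is_lead_mon1 : is_lead_mon (1 : {mpoly F[n]}) 0%MM.
Proof. by rewrite -mpolyX0; apply: is_lead_monX. Qed.

Lemma is_lead_mon_exp f m k : is_lead_mon f m -> is_lead_mon (f ^+ k) (m *+ k)%MM.
Proof.
move=> lf; elim: k => [|k IHk]; first by rewrite expr0 mulm0n; apply: is_lead_mon1.
by rewrite exprS mulmS; apply: is_lead_monM.
Qed.

Lemma is_lead_mon_prod (I : Type) (s : seq I) (f : I -> {mpoly F[n]})
    (mu : I -> 'X_{1..n}) :
  (forall i, is_lead_mon (f i) (mu i)) ->
  is_lead_mon (\prod_(i <- s) f i) (\big[+%MM/0%MM]_(i <- s) mu i).
Proof.
move=> lf; elim/big_rec2: _ => [|i m g _ lg]; first exact: is_lead_mon1.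
exact: is_lead_monM.
Qed.

(** Pairwise distinct lead monomials cannot cancel: the largest one survives. *)
Lemma is_lead_mon_sum (I : eqType) (s : seq I) (f : I -> {mpoly F[n]})
    (mu : I -> 'X_{1..n}) :
  s != [::] -> uniq s -> {in s &, injective mu} ->
  (forall i, i \in s -> is_lead_mon (f i) (mu i)) ->
  exists2 i, i \in s & is_lead_mon (\sum_(i <- s) f i) (mu i).
Proof.
elim: s => // i [|j s] IHs _ /andP[nis us] inj lf.
  by exists i; rewrite ?mem_head // big_seq1; apply: lf; rewrite mem_head.
have [||k kin lk] := IHs isT us.
- by move=> x y xin yin; apply: inj; rewrite inE ?xin ?yin orbT.
- by move=> x xin; apply: lf; rewrite inE xin orbT.
rewrite big_cons; have kin' : k \in i :: j :: s by rewrite inE kin orbT.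
have neq : mu i != mu k.
  by apply: contraNneq nis => /(inj _ _ (mem_head _ _) kin') ->.
have lfi := lf i (mem_head _ _).
case: (grevlex_total neq) => lt.
  exists k => //; rewrite addrC; apply: is_lead_mon_addl => // m'.
  exact: is_lead_mon_below lfi lt.
exists i; first exact: mem_head.
by apply: is_lead_mon_addl => // m'; apply: is_lead_mon_below lk lt.
Qed.

End LeadMonomials.

(** The exponent of the monomial obtained by substituting ['X_[mu i]] for the variable ['X_i] in
    ['X_[m]]. *)
Definition mnm_eval k n (mu : 'I_k -> 'X_{1..n}) (m : 'X_{1..k}) : 'X_{1..n} :=
  \big[+%MM/0%MM]_(i < k) (mu i *+ m i)%MM.

Lemma mnm_evalE k n (mu : 'I_k -> 'X_{1..n}) m j :
  mnm_eval mu m j = (\sum_(i < k) mu i j * m i)%N.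
Proof. by rewrite mnm_sumE; apply: eq_bigr => i _; rewrite mulmnE. Qed.

Lemma is_lead_mon_compX k n (F : fieldType) (g : k.-tuple {mpoly F[n]})
    (mu : 'I_k -> 'X_{1..n}) m :
  (forall i, is_lead_mon (tnth g i) (mu i)) ->
  is_lead_mon ('X_[m] \mPo g) (mnm_eval mu m).
Proof.
move=> lg; rewrite comp_mpolyX; apply: is_lead_mon_prod => i.
exact: is_lead_mon_exp.
Qed.

(** The non-cancellation criterion behind all later independence arguments: in particular [P \mPo g]
    is nonzero. *)
Lemma is_lead_mon_comp k n (F : fieldType) (g : k.-tuple {mpoly F[n]})
    (mu : 'I_k -> 'X_{1..n}) (P : {mpoly F[k]}) :
  (forall i, is_lead_mon (tnth g i) (mu i)) ->
  {in msupp P &, injective (mnm_eval mu)} -> P != 0 ->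
  exists2 m, m \in msupp P & is_lead_mon (P \mPo g) (mnm_eval mu m).
Proof.
move=> lg inj nzP; rewrite comp_mpolyEX; apply: is_lead_mon_sum => [||//|m mP].
- by rewrite msupp_eq0.
- exact: msupp_uniq.
by apply: is_lead_monZ; [rewrite -mcoeff_msupp | apply: is_lead_mon_compX].
Qed.


(** * Polynomials invariant under translations *)

Section ShiftInvariantPolynomials.

Variable R : idomainType.
Implicit Types (h : {poly R}) (s : seq R).

Lemma prod_XaddC_dvd s h :
  uniq s -> (forall a, a \in s -> h.[- a] = 0) ->
  exists k, h = k * \prod_(a <- s) ('X + a%:P).
Proof.
elim: s h => [|a s IHs] h /=; first by exists h; rewrite big_nil mulr1.
case/andP=> nas us h0.
have /factor_theorem[k defh] : root h (- a) by rewrite /root h0 ?mem_head.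
have [|k' defk] := IHs k us.
  move=> b bs; have /eqP := h0 b (mem_behead (s := a :: s) bs).
  rewrite defh polyCN opprK hornerM hornerD hornerX hornerC mulf_eq0.
  case/orP=> [/eqP // |]; rewrite addrC subr_eq0 => /eqP eab.
  by rewrite eab bs in nas.
by exists k'; rewrite big_cons mulrCA -defk defh polyCN opprK mulrC.
Qed.

(** Induction on the size of [h]. Invariance gives [h.[- a] = h.[0]], so [h - h.[0]] vanishes at
    every [- a] and is a multiple [k * N] of the product; cancelling the invariant [N] shows that
    [k] is invariant too. *)
Lemma shift_invariant_comp s h :
  uniq s -> s != [::] ->
  (forall a, a \in s ->
     (\prod_(b <- s) ('X + b%:P)) \Po ('X + a%:P) = \prod_(b <- s) ('X + b%:P)) ->
  (forall a, a \in s -> h \Po ('X + a%:P) = h) ->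
  exists Q, h = Q \Po (\prod_(a <- s) ('X + a%:P)).
Proof.
set N := \prod_(b <- s) _ => us ns invN.
have szN : size N = (size s).+1.
  rewrite -(size_prod_XsubC s (fun a => - a)) /N; congr (size (polyseq _)).
  by apply: eq_bigr => a _; rewrite polyCN opprK.
have [m] := ubnP (size h); elim: m h => // m IHm h lehm invh.
have [|k defh] := prod_XaddC_dvd (h := h - h.[0]%:P) us.
  move=> a ain; rewrite hornerD hornerN hornerC -{1}(invh a ain) horner_comp.
  by rewrite hornerD hornerX hornerC addNr subrr.
have [k0|nzk] := eqVneq k 0.
  by exists h.[0]%:P; rewrite comp_polyC; apply/eqP; rewrite -subr_eq0 defh k0 mul0r.
have nzN : N != 0 by rewrite -size_poly_eq0 szN.
have [||Q defk] := IHm k.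
(* Subtracting [h.[0]] does not raise the size, as [h = 0] would force [k = 0]. Since [s] is
   nonempty, [N] has positive degree, and [k] is strictly smaller than [h]. *)
- have : (size (k * N)%R <= size h)%N.
    rewrite -defh; apply: leq_trans (size_polyD _ _) _.
    rewrite geq_max leqnn size_polyN; apply: leq_trans (size_polyC_leq1 _) _.
    rewrite lt0n size_poly_eq0; apply/eqP => h0; move: defh nzk.
    rewrite h0 horner0 subr0 => /esym/eqP.
    by rewrite mulf_eq0 (negPf nzN) orbF => ->.
  rewrite size_mul // szN addnS /= => lekh.
  rewrite -ltnS; apply: leq_trans lehm; rewrite ltnS.
  apply: leq_trans lekh; rewrite -[X in (X < _)%N]addn0 ltn_add2l.
  by rewrite lt0n size_eq0.
- move=> a ain; apply: (mulIf nzN); rewrite -{1}(invN a ain) -comp_polyM -defh.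
  by rewrite comp_polyB comp_polyC invh.
exists (Q * 'X + h.[0]%:P).
by rewrite comp_polyD comp_polyM comp_polyX comp_polyC -defk -defh subrK.
Qed.

End ShiftInvariantPolynomials.

(** * Reindexing over a finite additive subgroup *)

Section AdditiveSubgroup.

Variables (V : zmodType) (W : {fset V}).
Hypothesis W_subgroup : zmod_closed (mem W).

Lemma fset_sub_oppr c : c \in W -> - c \in W.
Proof. by move=> cW; have [W0 WB] := W_subgroup; rewrite -sub0r WB. Qed.

Lemma perm_translate c : c \in W -> perm_eq [seq c + e | e <- W] W.
Proof.
move=> cW; have [W0 WB] := W_subgroup; apply: uniq_perm; rewrite ?fset_uniq //.
  by rewrite map_inj_uniq ?fset_uniq //; apply: addrI.
move=> e; apply/mapP/idP => [[a aW ->]|eW].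
  by rewrite -[a]opprK; apply: WB => //; apply: fset_sub_oppr.
by exists (e - c); [apply: WB | rewrite addrC subrK].
Qed.

Lemma perm_opp : perm_eq [seq - e | e <- W] W.
Proof.
apply: uniq_perm; rewrite ?fset_uniq //.
  by rewrite map_inj_uniq ?fset_uniq //; apply: oppr_inj.
move=> e; apply/mapP/idP => [[a aW ->]|eW]; first exact: fset_sub_oppr.
by exists (- e); rewrite ?opprK //; apply: fset_sub_oppr.
Qed.

End AdditiveSubgroup.

Lemma prodrN_seq (R : comNzRingType) (I : Type) (s : seq I) (f : I -> R) :
  \prod_(i <- s) - f i = (-1) ^+ size s * \prod_(i <- s) f i.
Proof.
elim: s => [|i s IHs]; first by rewrite !big_nil mulr1.
by rewrite !big_cons IHs exprS /=; ring.
Qed.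

Lemma prodr_constMl_seq (R : comNzRingType) (I : Type) (s : seq I) (f : I -> R) x :
  \prod_(i <- s) (x * f i) = x ^+ size s * \prod_(i <- s) f i.
Proof.
elim: s => [|i s IHs]; first by rewrite !big_nil mulr1.
by rewrite !big_cons IHs exprS /=; ring.
Qed.

(** * A product identity for squares of translates *)

Section SquareFactors.

Variables (R : idomainType) (V : seq R) (y : R).
Hypotheses (V_uniq : uniq V) (V_odd : odd (size V)).
Hypothesis V_opp : perm_eq [seq - a | a <- V] V.
Hypothesis V_translate : forall a, a \in V -> perm_eq [seq a + b | b <- V] V.
(** Makes the squares [(y + a) ^+ 2] pairwise distinct, since the difference of two of them is
    [(a - b) * (y + a + (y + b))]. *)
Hypothesis y_generic : forall a b, a \in V -> b \in V -> y + a + (y + b) != 0.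

Lemma prod_subr_symm (z : R) : \prod_(a <- V) (z - a) = \prod_(a <- V) (z + a).
Proof.
rewrite -(perm_big _ V_opp) /= big_map.
by apply: eq_bigr => a _; rewrite opprK.
Qed.

Lemma prod_sqr_subr (z : R) :
  \prod_(a <- V) (z ^+ 2 - a ^+ 2) = (\prod_(a <- V) (z + a)) ^+ 2.
Proof.
rewrite [RHS]expr2 -[X in X * _]prod_subr_symm -big_split /=.
by apply: eq_bigr => a _; ring.
Qed.

Lemma prod_addr_translate (z a : R) :
  a \in V -> \prod_(b <- V) (z + a + b) = \prod_(b <- V) (z + b).
Proof.
move=> aV; rewrite -[RHS](perm_big _ (V_translate aV)) /= big_map.
by apply: eq_bigr => b _; rewrite addrA.
Qed.

(* The difference of the two sides is a polynomial in [s] of degree less than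
   [size V], since [size V] is odd, with the [size V] roots [(y + a) ^+ 2]. *)
Lemma prod_sqr_translate (s : R) :
  \prod_(a <- V) ((y + a) ^+ 2 - s)
    = (\prod_(a <- V) (y + a)) ^+ 2 - \prod_(a <- V) (s - a ^+ 2).
Proof.
pose N := \prod_(a <- V) (y + a).
pose D1 : {poly R} := \prod_(a <- V) ('X - ((y + a) ^+ 2)%:P).
pose D2 : {poly R} := \prod_(a <- V) ('X - (a ^+ 2)%:P).
pose A := D2 - D1 - (N ^+ 2)%:P.
have evalA t : A.[t] = \prod_(a <- V) (t - a ^+ 2) - N ^+ 2
                       + \prod_(a <- V) ((y + a) ^+ 2 - t).
  rewrite !(hornerD, hornerN, hornerC) /D1 /D2 !horner_prod addrAC.
  congr (_ - _ + _); first by apply: eq_bigr => a _; rewrite hornerXsubC.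
  (* The sign from reversing all the factors of [D1] is [-1] because [size V] is odd. *)
  rewrite -[LHS]mulN1r.
  have <- : (-1) ^+ size V = -1 :> R by rewrite -signr_odd V_odd.
  rewrite -prodrN_seq.
  by apply: eq_bigr => a _; rewrite hornerXsubC opprB.
suff A0 : A = 0.
  by have := evalA s; rewrite A0 horner0 => /esym/eqP;
    rewrite addrC addr_eq0 opprB => /eqP.
(* A nonzero [A] would satisfy [size V < size A] by its number of roots, and [size A <= size V] by
   comparison of coefficients. *)
apply: contraTeq (leqnn (size V)) => nzA; rewrite -ltnNge.
pose rs := [seq (y + a) ^+ 2 | a <- V].
have szrs : size rs = size V by rewrite size_map.
rewrite -{1}szrs; apply: leq_trans (max_poly_roots nzA _ _) _.
- apply/allP => _ /mapP[e eV ->]; rewrite /root evalA.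
  have -> : \prod_(a <- V) ((y + a) ^+ 2 - (y + e) ^+ 2) = 0.
    by apply/eqP; rewrite prodf_seq_eq0; apply/hasP; exists e; rewrite ?subrr ?eqxx.
  by rewrite prod_sqr_subr prod_addr_translate // addr0 subrr.
- rewrite map_inj_in_uniq // => a b aV bV /eqP; rewrite eqf_sqr => /orP[|].
    by move=> /eqP/addrI.
  by rewrite -addr_eq0 (negPf (y_generic aV bV)).
(* [D1] and [D2] are monic of degree [size V], so they agree from that degree on; the constant
   [N ^+ 2] only affects degree 0, which is smaller because [size V] is odd, hence positive. *)
apply/leq_sizeP => j lej; rewrite !(coefB, coefC).
have coefD (f : R -> R) : (\prod_(a <- V) ('X - (f a)%:P))`_j = (j == size V)%:R.
  have szD := size_prod_XsubC V f.
  case: eqVneq => [->|neq].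
    by have /monicP := monic_prod_XsubC V xpredT f; rewrite lead_coefE szD.
  by rewrite nth_default // szD ltn_neqAle eq_sym neq.
rewrite (coefD (fun a => a ^+ 2)) (coefD (fun a => (y + a) ^+ 2)) subrr sub0r.
have : (0 < size V)%N by case: V V_odd.
by case: j lej {coefD} => [|j] lej; [rewrite ltnNge lej | rewrite /= oppr0].
Qed.

End SquareFactors.

(** * The action of W and its generating invariants *)

Lemma rmorph_mpoly_eq (n : nat) (R : nzRingType) (S : nzRingType)
    (phi psi : {rmorphism {mpoly R[n]} -> S}) :
  (forall c, phi c%:MP = psi c%:MP) -> (forall i, phi 'X_i = psi 'X_i) ->
  phi =1 psi.
Proof.
move=> eqC eqX f; rewrite [f]mpolyE !rmorph_sum; apply: eq_bigr => m _ /=.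
rewrite -mul_mpolyC !rmorphM eqC mpolyXE_id !rmorph_prod; congr (_ * _).
by apply: eq_bigr => i _; rewrite !rmorphXn eqX.
Qed.

Lemma comp_mpoly_comp (F : comNzRingType) k n l (P : {mpoly F[k]})
    (g : k.-tuple {mpoly F[n]}) (h : n.-tuple {mpoly F[l]}) :
  (P \mPo g) \mPo h = P \mPo [tuple tnth g i \mPo h | i < k].
Proof.
pose g' := [tuple tnth g i \mPo h | i < k].
apply: (@rmorph_mpoly_eq _ _ _ (comp_mpoly h \o comp_mpoly g) (comp_mpoly g'))
  => [c|i] /=.
  by rewrite !comp_mpolyC.
by rewrite !comp_mpolyXU -!tnth_nth tnth_mktuple.
Qed.

Local Notation i0 := (@Ordinal 3 0 isT).
Local Notation i1 := (@Ordinal 3 1 isT).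
Local Notation i2 := (@Ordinal 3 2 isT).

Section Action.

Variable F : fieldType.
Implicit Types (c e : F).
Local Notation x := (vx F).
Local Notation y := (vy F).
Local Notation z := (vz F).

Lemma W_act_x c : W_act c x = x. Proof. by rewrite /W_act comp_mpolyXU. Qed.
Lemma W_act_y c : W_act c y = y_act c. Proof. by rewrite /W_act comp_mpolyXU. Qed.
Lemma W_act_z c : W_act c z = z_act c. Proof. by rewrite /W_act comp_mpolyXU. Qed.

Lemma W_actZ c a (f : {mpoly F[3]}) : W_act c (a *: f) = a *: W_act c f.
Proof. exact: comp_mpolyZ. Qed.

Lemma W_actD c (f g : {mpoly F[3]}) : W_act c (f + g) = W_act c f + W_act c g.
Proof. exact: comp_mpolyD. Qed.

Lemma W_actB c (f g : {mpoly F[3]}) : W_act c (f - g) = W_act c f - W_act c g.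
Proof. exact: comp_mpolyB. Qed.

Lemma W_actM c (f g : {mpoly F[3]}) : W_act c (f * g) = W_act c f * W_act c g.
Proof. exact: rmorphM. Qed.

Lemma W_act_prod c I (s : seq I) (f : I -> {mpoly F[3]}) :
  W_act c (\prod_(i <- s) f i) = \prod_(i <- s) W_act c (f i).
Proof. exact: rmorph_prod. Qed.

Lemma x_neq0 : x != 0.
Proof. by rewrite -msupp_eq0 msuppX. Qed.

Lemma scale_x_inj : injective (fun c => c *: x).
Proof.
move=> c e /eqP; rewrite -subr_eq0 -scalerBl scaler_eq0 (negPf x_neq0) orbF.
by rewrite subr_eq0 => /eqP.
Qed.

Lemma W_act_y_act c e : W_act c (y_act e) = y_act (c + e).
Proof. by rewrite W_actD W_actZ W_act_x W_act_y /y_act scalerDl addrA. Qed.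

Lemma W_act_z_act c e : W_act c (z_act e) = z_act (c + e).
Proof.
rewrite !W_actD !W_actZ W_act_x W_act_y W_act_z /z_act /y_act -!mul_mpolyC.
by rewrite !(mpolyCM, mpolyCD, expr2); ring.
Qed.

Lemma W_act_delta c : W_act c (delta F) = delta F.
Proof.
rewrite /delta expr2 W_actB !W_actM W_act_x W_act_y W_act_z.
rewrite /z_act /y_act -!mul_mpolyC.
by rewrite !(mpolyCM, expr2); ring.
Qed.

(** Turns [x ^+ q * Nz W] into the left-hand side of [prod_sqr_translate] at [s = delta]. *)
Lemma x_mul_z_act c : x * z_act c = (y + c *: x) ^+ 2 - delta F.
Proof. by rewrite /z_act /delta -!mul_mpolyC !(mpolyCM, expr2); ring. Qed.

Lemma W_act_homog c d (f : {mpoly F[3]}) : f \is d.-homog -> W_act c f \is d.-homog.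
Proof.
move=> /dhomogP homf; rewrite /W_act comp_mpolyE big_seq.
apply: rpred_sum => m /homf /= <-; apply: rpredZ.
rewrite !big_ord_recl big_ord0 mulr1 mdegE !big_ord_recl big_ord0 addn0.
have homX i : ('X_i : {mpoly F[3]}) \is 1.-homog by rewrite dhomogX /= mdeg1.
by do 2?apply: dhomogM; rewrite -[X in X.-homog]mul1n; apply: dhomogMn;
  do ?apply: rpredD; do ?apply: rpredZ; apply: homX.
Qed.

End Action.

(** The action preserves degrees, so it commutes with taking homogeneous components. *)
Lemma pihomog_invariant (F : fieldType) (W : {fset F}) d f :
  W_invariant W f -> W_invariant W (pihomog mdeg d f).
Proof.
move=> invf c cW; rewrite -[in RHS](invf c cW).
(* The bound exceeds all degrees in [f] and also [d], so that the component of degree [d] occurs in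
   the sum even when it is zero. *)
set b := maxn (msize f) d.+1.
have lt_d : (d < b)%N by rewrite leq_max ltnSn orbT.
have -> : W_act c f = \sum_(e < b) W_act c (pihomog mdeg e f).
  rewrite {1}(@pihomog_partitionE _ _ mdeg b f) ?leq_maxl //.
  by rewrite /W_act linear_sum.
rewrite linear_sum (bigD1 (Ordinal lt_d)) //= big1 => [|e ne_ed].
  by rewrite addr0 [RHS]pihomog_dE //; apply: W_act_homog; apply: pihomogP.
apply: (pihomog_ne0 (d := e)); first exact: ne_ed.
by apply: W_act_homog; apply: pihomogP.
Qed.

(** * Invariance of the generators and the relation between them *)

Section Generators.

Variables (F : fieldType) (W : {fset F}).
Hypotheses (two_neq0 : 2%:R != 0 :> F) (W_odd : odd #|` W|).
Hypothesis W_subgroup : zmod_closed (mem W).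

Local Notation q := (#|` W|).
Local Notation x := (vx F).
Local Notation y := (vy F).
Local Notation V := [seq c *: x | c <- W].

Lemma W_act_Ny c : c \in W -> W_act c (Ny W) = Ny W.
Proof.
move=> cW; rewrite W_act_prod /Ny -[RHS](perm_big _ (perm_translate W_subgroup cW)).
by rewrite /= big_map; apply: eq_bigr => e _; rewrite W_act_y_act.
Qed.

Lemma W_act_Nz c : c \in W -> W_act c (Nz W) = Nz W.
Proof.
move=> cW; rewrite W_act_prod /Nz -[RHS](perm_big _ (perm_translate W_subgroup cW)).
by rewrite /= big_map; apply: eq_bigr => e _; rewrite W_act_z_act.
Qed.

Lemma gens_invariant g : g \in gens W -> W_invariant W g.
Proof.
rewrite !inE => /or4P[] /eqP -> c cW.
- exact: W_act_x.
- exact: W_act_delta.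
- exact: W_act_Ny.
- exact: W_act_Nz.
Qed.

Lemma uniq_V : uniq V.
Proof. by rewrite map_inj_uniq ?fset_uniq //; apply: scale_x_inj. Qed.

Lemma V_odd : odd (size V). Proof. by rewrite size_map. Qed.

Lemma perm_V_opp : perm_eq [seq - a | a <- V] V.
Proof.
rewrite -map_comp (eq_map (g := ( *:%R^~ x) \o -%R)) => [|c /=]; last first.
  by rewrite scaleNr.
by rewrite map_comp perm_map ?perm_opp.
Qed.

Lemma perm_V_translate a : a \in V -> perm_eq [seq a + b | b <- V] V.
Proof.
case/mapP=> c cW ->; rewrite -map_comp.
rewrite (eq_map (g := ( *:%R^~ x) \o +%R c)) => [|e /=]; last by rewrite scalerDl.
by rewrite map_comp perm_map ?perm_translate.
Qed.

Lemma y_generic a b : a \in V -> b \in V -> y + a + (y + b) != 0.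
Proof.
case/mapP=> c _ ->{a} /mapP[e _ ->{b}].
(* The coefficient of [y] in the sum is 2, as [a] and [b] are multiples of [x]. *)
apply: contraNneq two_neq0 => /(congr1 (fun f => f@_U_(i1))).
rewrite !(mcoeffD, mcoeffZ, mcoeffX, mcoeff0) eqxx.
rewrite !(eq_mnm1 _ _) /= !mulr0 !addr0 => <-.
by [].
Qed.

Lemma prod_sqr_x (t : {mpoly F[3]}) :
  \prod_(a <- V) (t - a ^+ 2) = \prod_(c <- W) (t - c ^+ 2 *: x ^+ 2).
Proof. by rewrite big_map; apply: eq_bigr => c _; rewrite exprZn. Qed.

Lemma Ny_sqr : Ny W ^+ 2 = \prod_(c <- W) (y ^+ 2 - c ^+ 2 *: x ^+ 2).
Proof.
rewrite -prod_sqr_x prod_sqr_subr ?perm_V_opp //; congr (_ ^+ 2).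
by rewrite big_map.
Qed.

Lemma Ny_Nz_delta :
  x ^+ q * Nz W = Ny W ^+ 2 - \prod_(c <- W) (delta F - c ^+ 2 *: x ^+ 2).
Proof.
rewrite -prodr_constMl_seq -prod_sqr_x.
have -> : Ny W = \prod_(a <- V) (y + a) by rewrite big_map.
rewrite -(prod_sqr_translate uniq_V V_odd perm_V_opp perm_V_translate y_generic).
by rewrite big_map; apply: eq_bigr => c _; rewrite x_mul_z_act.
Qed.

Definition relH : {mpoly F[2]} :=
  \prod_(c <- W) ('X_(@Ordinal 2 1 isT) - c ^+ 2 *: 'X_(@Ordinal 2 0 isT) ^+ 2)
    - 'X_(@Ordinal 2 1 isT) ^+ q.

Lemma relH_comp n (s t : {mpoly F[n]}) :
  relH \mPo [tuple s; t] = \prod_(c <- W) (t - c ^+ 2 *: s ^+ 2) - t ^+ q.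
Proof.
rewrite /relH raddfB /= rmorph_prod rmorphXn /= comp_mpolyXU; congr (_ - _).
apply: eq_bigr => c _.
by rewrite raddfB /= comp_mpolyZ rmorphXn /= !comp_mpolyXU.
Qed.

Lemma relH_spec : HW_spec W q relH.
Proof. by rewrite /HW_spec relH_comp Ny_sqr exprM. Qed.

Lemma hsurf_relation_gens : hsurf_relation q relH \mPo gens W = 0.
Proof.
rewrite /hsurf_relation relH_comp !raddfD !raddfN /= rmorph_prod.
rewrite !(rmorphXn, rmorphM) /= !comp_mpolyXU /= Ny_Nz_delta.
have -> : \prod_(c <- W) ((T1 F - c ^+ 2 *: T0 F ^+ 2) \mPo gens W)
          = \prod_(c <- W) (delta F - c ^+ 2 *: x ^+ 2); last by ring.
apply: eq_bigr => c _.
by rewrite raddfB /= comp_mpolyZ rmorphXn /= !comp_mpolyXU.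
Qed.

End Generators.

(** * Normal forms modulo the relation *)

Section VariableDegree.

Variables (n : nat) (F : fieldType) (i : 'I_n).
Implicit Types (P Q U : {mpoly F[n]}).

(** A condition on the support, so the zero polynomial satisfies every bound. *)
Definition var_deg_le d P := forall m, m \in msupp P -> (m i <= d)%N.

Lemma var_deg_leD d P Q : var_deg_le d P -> var_deg_le d Q -> var_deg_le d (P + Q).
Proof. by move=> hP hQ m /msuppD_le; rewrite mem_cat => /orP[/hP|/hQ]. Qed.

Lemma var_deg_leZ d c P : var_deg_le d P -> var_deg_le d (c *: P).
Proof. by move=> hP m /msuppZ_le/hP. Qed.

Lemma var_deg_leN d P : var_deg_le d P -> var_deg_le d (- P).
Proof. by rewrite -scaleN1r; apply: var_deg_leZ. Qed.

Lemma var_deg_leX d (m : 'X_{1..n}) : (m i <= d)%N -> var_deg_le d 'X_[m].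
Proof. by move=> le_d m'; rewrite msuppX inE => /eqP->. Qed.

Lemma var_deg_le_sum d (I : eqType) (s : seq I) (p : pred I)
    (f : I -> {mpoly F[n]}) :
  (forall j, j \in s -> p j -> var_deg_le d (f j)) ->
  var_deg_le d (\sum_(j <- s | p j) f j).
Proof.
move=> hf; rewrite big_seq_cond; elim/big_ind: _ => [m||j /andP[]]; last exact: hf.
  by rewrite msupp0.
exact: var_deg_leD.
Qed.

Lemma var_deg_leM d e P Q :
  var_deg_le d P -> var_deg_le e Q -> var_deg_le (d + e) (P * Q).
Proof.
move=> hP hQ m /msuppM_le/allpairsP[[m1 m2] /= [/hP le1 /hQ le2 ->]].
by rewrite mnmDE leq_add.
Qed.

Lemma var_deg_le0_prod (I : Type) (s : seq I) (f : I -> {mpoly F[n]}) :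
  (forall j, var_deg_le 0 (f j)) -> var_deg_le 0 (\prod_(j <- s) f j).
Proof.
move=> hf; elim/big_ind: _ => // [|P Q]; last exact: var_deg_leM.
by rewrite -mpolyX0; apply: var_deg_leX; rewrite mnm0E.
Qed.

(** Modulo [rel] the square of ['X_i] becomes [U], which is free of ['X_i]; each replacement lowers
    the exponent of ['X_i] by two. The induction is on a bound for that exponent, and bounds 0 and 1
    need no reduction. *)
Lemma normal_form_mod_square U rel P :
  'X_i ^+ 2 = U - rel -> var_deg_le 0 U ->
  exists Q N, P = Q * rel + N /\ var_deg_le 1 N.
Proof.
move=> defX2 U0.
have [d degP] : exists d, var_deg_le d P.
  exists (\max_(m <- msupp P) m i)%N => m mP.
  exact: (@leq_bigmax_seq _ _ xpredT (fun m : 'X_{1..n} => m i)).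
elim: d P degP => [|[|k] IHk] P degP;
  try by exists 0, P; rewrite mul0r add0r; split=> // m /degP /leq_trans->.
pose good P := exists Q N, P = Q * rel + N /\ var_deg_le 1 N.
rewrite -/(good P) [P]mpolyE big_seq.
apply: big_ind => [|_ _ [Q1 [N1 [-> h1]]] [Q2 [N2 [-> h2]]]|m /degP le_m].
- by exists 0, 0; rewrite mul0r add0r; split=> // m; rewrite msupp0.
- by exists (Q1 + Q2), (N1 + N2); split; [ring | apply: var_deg_leD].
suff [Q [N [-> hN]]] : good 'X_[m].
  exists (P@_m *: Q), (P@_m *: N); rewrite scalerDr scalerAl; split=> //.
  exact: var_deg_leZ.
have [le_m'|lt_m] := leqP (m i) k.+1; first by apply: IHk; apply: var_deg_leX.
have le2m : (U_(i) *+ 2 <= m)%MM.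
  apply/mnm_lepP => j; rewrite mulmnE mnm1E; case: eqVneq => [<-|] //.
  by apply: leq_trans lt_m.
have [|Q [N [defN hN]]] := IHk ('X_[m - U_(i) *+ 2] * U).
  have -> : k.+1 = (k.+1 + 0)%N by rewrite addn0.
  apply: var_deg_leM => //; apply: var_deg_leX.
  by rewrite mnmBE mulmnE mnm1E eqxx mul1n leq_subLR add2n ltnW.
(* With [M] the monomial [m] divided by ['X_i ^+ 2], one has ['X_[m] = M * U - M * rel] and
   [M * U = Q * rel + N]. *)
exists (Q - 'X_[m - U_(i) *+ 2]), N; split=> //.
rewrite -{1}(submK le2m) mpolyXD -mpolyXn defX2 mulrBr defN.
by ring.
Qed.

End VariableDegree.

(** Sorts the monomials by divisibility by ['X_i]. The inclusion of supports lets [P0] inherit the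
    exponent bounds of [P] in the other variables. *)
Lemma split_var (n : nat) (F : fieldType) (i : 'I_n) (P : {mpoly F[n]}) :
  exists P1 P0, [/\ P = 'X_i * P1 + P0, var_deg_le i 0 P0
                  & {subset msupp P0 <= msupp P}].
Proof.
exists (\sum_(m <- msupp P | m i != 0%N) P@_m *: 'X_[m - U_(i)]).
exists (\sum_(m <- msupp P | m i == 0%N) P@_m *: 'X_[m]); split.
- rewrite {1}[P]mpolyE (bigID (fun m : 'X_{1..n} => m i != 0%N)) /=; congr (_ + _).
    rewrite mulr_sumr; apply: eq_bigr => m nz.
    by rewrite -scalerAr -mpolyXD addmC submK // lep1mP.
  by apply: eq_bigl => m; rewrite negbK.
- apply: var_deg_le_sum => m _ /eqP m0; apply: var_deg_leZ.
  by apply: var_deg_leX; rewrite m0.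
move=> m; rewrite mcoeff_msupp raddf_sum /=; apply: contraR => nmP.
rewrite big_seq_cond big1 ?eqxx // => m' /andP[m'P _].
rewrite mcoeffZ mcoeffX; case: eqVneq => [e|]; last by rewrite mulr0.
by rewrite -e m'P in nmP.
Qed.

Local Notation j0 := (@Ordinal 4 0 isT).
Local Notation j1 := (@Ordinal 4 1 isT).
Local Notation j2 := (@Ordinal 4 2 isT).
Local Notation j3 := (@Ordinal 4 3 isT).

Definition lead_gens (q : nat) : 4.-tuple 'X_{1..3} :=
  [tuple U_(i0); U_(i1) *+ 2; U_(i1) *+ q; U_(i2) *+ q]%MM.

Lemma mnm_eval_lead_gens q (m : 'X_{1..4}) :
  let e := mnm_eval (tnth (lead_gens q)) m in
  [/\ e i0 = m j0, e i1 = (2 * m j1 + q * m j2)%N & e i2 = (q * m j3)%N].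
Proof.
rewrite /= !mnm_evalE !big_ord_recl !big_ord0 !(tnth_nth 0%MM) /=.
rewrite !mulmnE !mnm1E /= !mul0n !mul1n !addn0 !add0n.
by split; do ?congr (_ + _)%N; do ?congr (_ * _)%N; congr (m _); apply: val_inj.
Qed.

(** The exponents of [x] and [z] determine [m j0] and [m j3]. The exponent of [y] is
    [2 * m j1 + q * m j2]; as [q] is odd, its parity determines [m j2 <= 1], and then [m j1]
    follows. *)
Lemma mnm_eval_lead_gens_inj q (m m' : 'X_{1..4}) :
  odd q -> (m j2 <= 1)%N -> (m' j2 <= 1)%N ->
  mnm_eval (tnth (lead_gens q)) m = mnm_eval (tnth (lead_gens q)) m' -> m = m'.
Proof.
move=> oddq le1 le1' eqe; have q_gt0 := odd_gt0 oddq.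
have [e0 e1 e2] := mnm_eval_lead_gens q m.
have [e0' e1' e2'] := mnm_eval_lead_gens q m'.
rewrite eqe in e0 e1 e2.
have h0 : m j0 = m' j0 by rewrite -e0.
have h3 : m j3 = m' j3.
  by apply/eqP; rewrite -(eqn_pmul2l q_gt0) -e2 e2'.
have h2 : m j2 = m' j2.
  have : odd (m j2) = odd (m' j2).
    by have := congr1 odd e1; rewrite e1' !mul2n !oddD !odd_double !oddM oddq.
  by case: (m j2) le1 => [|[|k]] // _; case: (m' j2) le1' => [|[|k']].
have h1 : m j1 = m' j1.
  by move: e1; rewrite e1' h2 => /eqP; rewrite eqn_add2r eqn_pmul2l // => /eqP.
apply/mnmP => -[[|[|[|[|j]]]] lej] //.
- by rewrite (_ : Ordinal lej = j0) //; apply: val_inj.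
- by rewrite (_ : Ordinal lej = j1) //; apply: val_inj.
- by rewrite (_ : Ordinal lej = j2) //; apply: val_inj.
- by rewrite (_ : Ordinal lej = j3) //; apply: val_inj.
Qed.

Section LeadMonomialsOfGenerators.

Variable F : fieldType.

Lemma grevlex_lt01 : grevlex_lt (U_(i0) : 'X_{1..3})%MM U_(i1)%MM.
Proof.
by apply/grevlex_ltP; right; rewrite !mdeg1; split=> //; exists i0; rewrite ?mnm1E.
Qed.

Lemma grevlex_lt02 : grevlex_lt (U_(i0) : 'X_{1..3})%MM U_(i2)%MM.
Proof.
by apply/grevlex_ltP; right; rewrite !mdeg1; split=> //; exists i0; rewrite ?mnm1E.
Qed.

Lemma grevlex_lt12 : grevlex_lt (U_(i1) : 'X_{1..3})%MM U_(i2)%MM.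
Proof.
apply/grevlex_ltP; right; rewrite !mdeg1; split=> //; exists i1; rewrite ?mnm1E //.
by move=> j ltj; rewrite !mnm1E -!val_eqE /= !gtn_eqF // (ltn_trans ltj).
Qed.

Lemma is_lead_mon_y_act (c : F) : is_lead_mon (y_act c) U_(i1)%MM.
Proof.
apply: is_lead_mon_addl; first exact: is_lead_monX.
by move=> m /msuppZ_le; rewrite msuppX inE => /eqP->; apply: grevlex_lt01.
Qed.

Lemma is_lead_mon_z_act (c : F) : is_lead_mon (z_act c) U_(i2)%MM.
Proof.
apply: is_lead_mon_addl; last first.
  by move=> m /msuppZ_le; rewrite msuppX inE => /eqP->; apply: grevlex_lt02.
apply: is_lead_mon_addl; first exact: is_lead_monX.
by move=> m /msuppZ_le; rewrite msuppX inE => /eqP->; apply: grevlex_lt12.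
Qed.

(** The reverse order decides here: [y ^+ 2] and [x * z] have equal degree, and the one containing
    [x] is smaller. *)
Lemma is_lead_mon_delta : is_lead_mon (delta F) (U_(i1) *+ 2)%MM.
Proof.
apply: is_lead_mon_addl; first exact/is_lead_mon_exp/is_lead_monX.
move=> m; rewrite (perm_mem (msuppN _)) -mpolyXD msuppX inE => /eqP->.
apply/grevlex_ltP; right; rewrite mdegMn mdegD !mdeg1; split=> //.
by exists i0; rewrite // mulmnE mnmDE !mnm1E.
Qed.

Lemma is_lead_mon_gens (W : {fset F}) i :
  is_lead_mon (tnth (gens W) i) (tnth (lead_gens #|` W|) i).
Proof.
have big_const (m : 'X_{1..3}) : (m *+ #|` W| = \big[+%MM/0]_(c <- W) m)%MM.
  rewrite big_const_seq count_predT -[X in iter X]/(#|` W|).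
  by elim: #|` W| => //= k <-; rewrite mulmS.
case: i => -[|[|[|[|i]]]] lei //; rewrite !(tnth_nth 0) !(tnth_nth 0%MM) /=.
- exact: is_lead_monX.
- exact: is_lead_mon_delta.
- by rewrite big_const; apply: is_lead_mon_prod => c; apply: is_lead_mon_y_act.
- by rewrite big_const; apply: is_lead_mon_prod => c; apply: is_lead_mon_z_act.
Qed.

End LeadMonomialsOfGenerators.

(** * The ideal of relations and division by [x] *)

Section Presentation.

Variables (F : fieldType) (W : {fset F}).
Hypotheses (two_neq0 : 2%:R != 0 :> F) (W_odd : odd #|` W|).
Hypothesis W_subgroup : zmod_closed (mem W).

Local Notation q := (#|` W|).
Local Notation x := (vx F).
Local Notation y := (vy F).
Local Notation mu := (mnm_eval (tnth (lead_gens q))).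
Local Notation rel := (hsurf_relation q (relH W)).

(** [x] and [y ^+ 2] are algebraically independent: distinct monomials in them have distinct lead
    monomials, so a nonzero [H - relH W] cannot be sent to 0. *)
Lemma relH_unique H : HW_spec W q H -> relH W = H.
Proof.
rewrite /HW_spec -relH_spec //; set g := [tuple x; y ^+ 2] => eqH.
apply/eqP; rewrite eq_sym -subr_eq0; apply/negPn/negP => nz.
pose nu := [tuple U_(i0); (U_(i1) *+ 2)%MM : 'X_{1..3}]%MM.
have lg i : is_lead_mon (tnth g i) (tnth nu i).
  case: i => -[|[|i]] lei //; rewrite !(tnth_nth 0) !(tnth_nth 0%MM) /=.
    exact: is_lead_monX.
  exact/is_lead_mon_exp/is_lead_monX.
have [m m' _ _ e|m _] := is_lead_mon_comp lg _ nz.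
  have := congr1 (fun m : 'X_{1..3} => (m i0, m i1)) e.
  rewrite !mnm_evalE !big_ord_recl !big_ord0 !(tnth_nth 0%MM) /=.
  rewrite !mulmnE !mnm1E /= !mul0n !mul1n !addn0 !add0n => -[e0 e1].
  apply/mnmP => -[[|[|j]] lej] //.
    by rewrite (_ : Ordinal lej = ord0) //; apply: val_inj.
  rewrite (_ : Ordinal lej = lift ord0 ord0) //; last exact: val_inj.
  by apply/eqP; rewrite -(eqn_pmul2l (isT : 0 < 2)%N) e1.
by rewrite raddfB /= eqH subrr => -[]; rewrite msupp0.
Qed.

Lemma normal_form (P : {mpoly F[4]}) :
  exists Q N, P = Q * rel + N /\ var_deg_le j2 1 N.
Proof.
(* The product is [T1 ^+ q + H(T0, T1)], so the relation reads [T2 ^+ 2 = U - rel], with [U] free of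
   [T2]. *)
pose U := \prod_(c <- W) (T1 F - c ^+ 2 *: T0 F ^+ 2) + T0 F ^+ q * T3 F.
apply: (@normal_form_mod_square _ _ _ U).
  by rewrite /hsurf_relation relH_comp /U -/(T2 F); ring.
have X0 j : j != j2 -> var_deg_le j2 0 ('X_j : {mpoly F[4]}).
  by move=> neq; apply: var_deg_leX; rewrite mnm1E (negPf neq).
have Xn0 j k : j != j2 -> var_deg_le j2 0 ('X_j ^+ k : {mpoly F[4]}).
  move=> neq; rewrite mpolyXn; apply: var_deg_leX.
  by rewrite mulmnE mnm1E (negPf neq).
apply: var_deg_leD; last first.
  by apply: (@var_deg_leM _ _ _ 0 0); [apply: Xn0 | apply: X0].
apply: var_deg_le0_prod => c; apply: var_deg_leD; first exact: X0.
by apply/var_deg_leN/var_deg_leZ/Xn0.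
Qed.

Lemma rel_gens Q N : (Q * rel + N) \mPo gens W = N \mPo gens W.
Proof. by rewrite comp_mpolyD rmorphM /= hsurf_relation_gens // mulr0 add0r. Qed.

Lemma normal_form_lead N : var_deg_le j2 1 N -> N != 0 ->
  exists2 m, m \in msupp N & is_lead_mon (N \mPo gens W) (mu m).
Proof.
move=> nfN nzN; apply: is_lead_mon_comp nzN; first exact: is_lead_mon_gens.
by move=> m m' /nfN le /nfN le'; apply: mnm_eval_lead_gens_inj.
Qed.

Lemma ideal_of_relations P : (P \mPo gens W) = 0 <-> exists Q, P = Q * rel.
Proof.
split=> [|[Q ->]]; last by rewrite rmorphM /= hsurf_relation_gens // mulr0.
have [Q [N [-> nfN]]] := normal_form P; rewrite rel_gens => N0.
have [->|nzN] := eqVneq N 0; first by exists Q; rewrite addr0.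
by have [m _] := normal_form_lead nfN nzN; rewrite N0 => -[]; rewrite msupp0.
Qed.

(** Write the normal form of [P] as [T0 * N1 + N0] with [N0] free of [T0]. The value of [N0] is a
    multiple of [x]; were [N0] nonzero, that value would have a lead monomial without [x]. So
    [N0 = 0], and [x] cancels. *)
Lemma gens_div_x P f : P \mPo gens W = x * f -> exists P', f = P' \mPo gens W.
Proof.
have [Q [N [-> nfN]]] := normal_form P; rewrite rel_gens => {P Q}.
have [N1 [N0 [defN N0x sub]]] := split_var j0 N.
rewrite defN comp_mpolyD rmorphM /= comp_mpolyXU /= => defxf.
exists N1; apply: (mulfI (x_neq0 F)); rewrite -defxf.
have [->|nzN0] := eqVneq N0 0; first by rewrite comp_mpoly0 addr0.
have [m mN0 []] := normal_form_lead (fun m mN0 => nfN m (sub m mN0)) nzN0.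
have -> : N0 \mPo gens W = x * (f - (N1 \mPo gens W)).
  by rewrite mulrBr -defxf addrC addKr.
have [e0 _ _] := mnm_eval_lead_gens q m.
(* Every monomial of a multiple of [x] has positive exponent at [x], whereas this one has exponent
   [m j0 = 0]. *)
move=> /msuppM_le/allpairsP[[m1 m2] /= [+ _ eqm]] _.
rewrite msuppX inE => /eqP em1; move: e0; rewrite eqm em1 mnmDE mnm1E eqxx.
by move: (N0x m mN0); rewrite leqn0 => /eqP->.
Qed.

Lemma gens_div_xn P f n :
  P \mPo gens W = x ^+ n * f -> exists P', f = P' \mPo gens W.
Proof.
elim: n f => [|n IHn] f; first by rewrite mul1r => <-; exists P.
by rewrite exprSr -mulrA => /IHn[P' /esym/gens_div_x].
Qed.

End Presentation.

(** * Invariants up to a power of x *)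

Section Localisation.

Variables (F : fieldType) (W : {fset F}).
Hypothesis W_subgroup : zmod_closed (mem W).

Local Notation x := (vx F).
Local Notation y := (vy F).
Local Notation S := {mpoly F[2]}.
Local Notation X0 := ('X_(@Ordinal 2 0 isT) : S).
Local Notation X1 := ('X_(@Ordinal 2 1 isT) : S).

(* [theta f] is [f (x ^+ 2, x * Y, Y ^+ 2 - s)], where [X0] stands for [x], [X1]
   for [s], and the action of [c] becomes the shift [Y |-> Y + c x]. *)
Definition theta_coef : F -> {poly S} := polyC \o @mpolyC 2 F.
Definition theta_var (i : 'I_3) : {poly S} :=
  [tuple (X0 ^+ 2)%:P; X0%:P * 'X; 'X ^+ 2 - X1%:P]`_i.
Definition theta (f : {mpoly F[3]}) : {poly S} := mmap theta_coef theta_var f.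

HB.instance Definition _ := GRing.RMorphism.on theta_coef.
HB.instance Definition _ := GRing.RMorphism.copy theta (mmap theta_coef theta_var).

Lemma thetaC c : theta c%:MP = (c%:MP)%:P.
Proof. exact: mmapC. Qed.

Lemma thetaXU i : theta 'X_i = theta_var i.
Proof. by rewrite /theta mmapX mmap1U. Qed.

Lemma thetaZ c f : theta (c *: f) = (c%:MP)%:P * theta f.
Proof. by rewrite -mul_mpolyC rmorphM /= thetaC. Qed.

(** Both sides are ring morphisms in [f], so the variables suffice; for [z] this is the expansion of
    [(Y + c x) ^+ 2 - s]. *)
Lemma theta_W_act c f : theta (W_act c f) = theta f \Po ('X + (c *: X0)%:P).
Proof.
pose g := [tuple x; y_act c; z_act c]; pose s := 'X + (c *: X0)%:P : {poly S}.
apply: (@rmorph_mpoly_eq _ _ _ (theta \o comp_mpoly g) (comp_poly s \o theta))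
  => [a|i] /=.
  by rewrite comp_mpolyC !thetaC comp_polyC.
rewrite comp_mpolyXU thetaXU; case: i => -[|[|[|i]]] lei //.
- by rewrite /= thetaXU /theta_var /= comp_polyC.
- rewrite /= rmorphD /= thetaZ !thetaXU /theta_var /=.
  rewrite comp_polyM comp_polyC comp_polyX /s -mul_mpolyC polyCM.
  by rewrite !polyCM; ring.
rewrite /= !rmorphD /= !thetaZ !thetaXU /theta_var /=.
rewrite -polyCN !expr2 comp_polyM comp_polyC comp_polyX /s -mul_mpolyC.
rewrite mulr_natl mulr2n !(mpolyCM, mpolyCD, polyCM, polyCD, polyCN).
by ring.
Qed.

(** Together with [untheta], this puts back [delta] for [s] and [y] for [Y]. *)
Definition untheta_coef : S -> {mpoly F[3]} := comp_mpoly [tuple x; delta F].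
HB.instance Definition _ := GRing.RMorphism.on untheta_coef.
Definition untheta (h : {poly S}) : {mpoly F[3]} := (map_poly untheta_coef h).[y].
HB.instance Definition _ := GRing.RMorphism.copy untheta
  (horner_eval y \o map_poly untheta_coef).

(** Since [y ^+ 2 - delta = x * z], the composite multiplies each variable by [x]. On degree [d]
    this is the factor [x ^+ d], which replaces computing with fractions in [x]. *)
Lemma untheta_theta d f : f \is d.-homog -> untheta (theta f) = x ^+ d * f.
Proof.
move=> homf; pose g := [tuple x * 'X_i | i < 3].
have -> : untheta (theta f) = f \mPo g.
  apply: (@rmorph_mpoly_eq _ _ _ (untheta \o theta) (comp_mpoly g)) => [a|i] /=.
    by rewrite thetaC /untheta map_polyC hornerC /= /untheta_coef !comp_mpolyC.
  rewrite comp_mpolyXU -tnth_nth tnth_mktuple thetaXU /untheta.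
  case: i => -[|[|[|i]]] lei //; rewrite /theta_var /=.
  - rewrite map_polyC hornerC /= /untheta_coef rmorphXn /= comp_mpolyXU /=.
    by rewrite expr2; congr (_ * 'X_ _); apply: val_inj.
  - rewrite rmorphM /= map_polyC map_polyX hornerM hornerX hornerC /=.
    rewrite /untheta_coef comp_mpolyXU /=.
    by congr (_ * 'X_ _); apply: val_inj.
  rewrite rmorphB rmorphXn /= map_polyC map_polyX.
  rewrite hornerD hornerN hornerC hornerXn /=.
  rewrite /untheta_coef comp_mpolyXU /= /delta subKr.
  by congr (_ * 'X_ _); apply: val_inj.
rewrite comp_mpolyE {3}[f]mpolyE mulr_sumr !big_seq; apply: eq_bigr => m mf.
rewrite -scalerAr; congr (_ *: _); rewrite mpolyXE_id -(dhomogP _ _ _ homf m mf).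
rewrite /= mdegE -prodrXr -big_split /=; apply: eq_bigr => i _.
by rewrite tnth_mktuple exprMn.
Qed.

(** [theta f] is invariant under the shifts by [c x], hence a polynomial in the product of the
    [Y + c x] over [F[x, s]]; [untheta] sends that product to [Ny W]. *)
Lemma invariant_localisation d f : f \is d.-homog -> W_invariant W f ->
  exists P, P \mPo gens W = x ^+ d * f.
Proof.
move=> homf invf; pose V := [seq c *: X0 | c <- W].
have X0_neq0 : X0 != 0 by rewrite -msupp_eq0 msuppX.
have uniqV : uniq V.
  rewrite map_inj_uniq ?fset_uniq // => a b /eqP.
  by rewrite -subr_eq0 -scalerBl scaler_eq0 (negPf X0_neq0) orbF subr_eq0 => /eqP.
have [W0 _] := W_subgroup.
have nV : V != [::].
  apply/eqP => V0; have := map_f (fun c => c *: X0) (W0 : 0 \in enum_fset W).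
  by rewrite -/V V0.
have [||Q defQ] := @shift_invariant_comp _ V (theta f) uniqV nV.
- move=> _ /mapP[c cW ->]; rewrite rmorph_prod /= !big_map.
  rewrite -[RHS](perm_big _ (perm_translate W_subgroup cW)) /= big_map.
  apply: eq_bigr => e _; rewrite comp_polyD comp_polyX comp_polyC.
  by rewrite scalerDl polyCD addrA.
- by move=> _ /mapP[c cW ->]; rewrite -theta_W_act invf.
(* [Q] with its coefficient variables read as [x], [delta] and its main variable as [Ny W]. *)
exists (map_poly (comp_mpoly [tuple T0 F; T1 F]) Q).[T2 F].
rewrite -(untheta_theta homf) defQ -horner_map /= comp_mpolyXU /=.
rewrite /untheta map_comp_poly horner_comp -map_poly_comp; congr _.[_].
  apply: eq_map_poly => u /=; rewrite comp_mpoly_comp; congr comp_mpoly.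
  apply: eq_from_tnth => i; rewrite tnth_mktuple.
  by case: i => -[|[|i]] lei //; rewrite !(tnth_nth 0) comp_mpolyXU.
rewrite rmorph_prod horner_prod big_map; apply: eq_bigr => c _ /=.
rewrite rmorphD /= map_polyX map_polyC hornerD hornerX hornerC.
by rewrite /= /untheta_coef comp_mpolyZ comp_mpolyXU.
Qed.

End Localisation.

(** * Generation of the invariant ring and the SAGBI property *)

Lemma comp_invariant (F : fieldType) (W : {fset F}) k (g : k.-tuple {mpoly F[3]}) P :
  (forall i, W_invariant W (tnth g i)) -> W_invariant W (P \mPo g).
Proof.
move=> invg c cW; rewrite /W_act comp_mpoly_comp; congr comp_mpoly.
by apply: eq_from_tnth => i; rewrite tnth_mktuple; apply: invg.
Qed.

Lemma mpolyX_mnm_eval k n (R : comNzRingType) (mu : 'I_k -> 'X_{1..n}) m :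
  'X_[mnm_eval mu m] = 'X_[m] \mPo [tuple 'X_[mu i] | i < k] :> {mpoly R[n]}.
Proof.
rewrite comp_mpolyX (big_morph _ (@mpolyXD _ _) (@mpolyX0 _ _)).
by apply: eq_bigr => i _; rewrite tnth_mktuple mpolyXn.
Qed.

Lemma lead_mons_comp (n : nat) (F : fieldType) (S : {mpoly F[n]} -> Prop)
    k (g : k.-tuple {mpoly F[n]}) m :
  S 1 -> (forall f h, S f -> S h -> S (f * h)) ->
  (forall i, lead_mons S (tnth g i)) -> lead_mons S ('X_[m] \mPo g).
Proof.
move=> S1 SM lg; rewrite comp_mpolyX.
have L1 : lead_mons S 1.
  by exists 1, 0%MM; split; rewrite ?mpolyX0 //; apply: is_lead_mon1.
have LM f h : lead_mons S f -> lead_mons S h -> lead_mons S (f * h).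
  move=> [f' [mf [Sf lf ->]]] [h' [mh [Sh lh ->]]].
  by exists (f' * h'), (mf + mh)%MM; rewrite mpolyXD;
    split; [apply: SM | apply: is_lead_monM | ].
apply: big_ind => // i _; elim: (m i) => // e IHe.
by rewrite exprS; apply: LM.
Qed.

Theorem theorem4p3 (p r : nat) (F : fieldType) (W : {fset F})
    (p_gt2 : (2 < p)%N) (charFp : p \in [pchar F])
    (W_subgroup : zmod_closed (mem W)) (W_order : #|` W| = (p ^ r)%N) :
  exists H : {mpoly F[2]},
    unique (HW_spec W (p ^ r)) H /\
    [/\ forall f : {mpoly F[3]},
          W_invariant W f <-> subalg_gen (fun g : {mpoly F[3]} => g \in gens W) f,
        forall P : {mpoly F[4]},
          (P \mPo gens W) = 0 <->
          exists Q : {mpoly F[4]}, P = Q * hsurf_relation (p ^ r) H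
      & is_sagbi_basis (fun g : {mpoly F[3]} => g \in gens W) (W_invariant W)].
Proof.
have p_pr := pcharf_prime charFp.
have odd_p : odd p by case: (even_prime p_pr) p_gt2 => [->|].
have W_odd : odd #|` W| by rewrite W_order oddX odd_p orbT.
have two_neq0 : 2%:R != 0 :> F.
  by rewrite -(dvdn_pcharf charFp) gtnNdvd.
rewrite -W_order; exists (relH W).
(* Each homogeneous component of [f] is invariant and lies in the generated algebra after
   multiplication by a power of [x], which is then divided out. *)
have inv_gens f : W_invariant W f -> exists P, f = P \mPo gens W.
  move=> invf; rewrite (pihomog_partitionE (mf := mdeg) (leqnn (msize f))).
  apply: (big_ind (fun u => exists P, u = P \mPo gens W))
    => [|_ _ [P ->] [Q ->]|d _].
  - by exists 0; rewrite comp_mpoly0.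
  - by exists (P + Q); rewrite comp_mpolyD.
  have [P defP] := invariant_localisation W_subgroup (pihomogP mdeg d f)
    (pihomog_invariant d invf).
  exact: (gens_div_xn _ _ _ defP).
split; first by split; [apply: relH_spec | apply: relH_unique].
split=> [f|P|].
- split=> [/inv_gens[P ->]|[k [g [P [gW ->]]]]].
    by exists 4, (gens W), P; split=> // i; apply: mem_tnth.
  by apply: comp_invariant => i; apply: gens_invariant.
- exact: ideal_of_relations.
split=> [f|f]; first exact: gens_invariant.
split=> [[k [g [P [lg ->]]]]|[s [ls ->]]].
  (* Expand [P] into monomials: a product of lead monomials of generators is the lead monomial of a
     product of invariants. *)
  exists [seq (P@_m, 'X_[m] \mPo g) | m <- msupp P]; split.
    move=> _ /mapP[m _ ->] /=; apply: lead_mons_comp => [c _|f1 f2 inv1 inv2 c cW|i].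
    - exact: comp_mpoly1.
    - by rewrite W_actM inv1 ?inv2.
    have [f1 [m1 [f1W lf1 ->]]] := lg i.
    by exists f1, m1; split=> //; apply: gens_invariant.
  by rewrite big_map comp_mpolyEX.
exists 4; exists [tuple 'X_[tnth (lead_gens #|` W|) i] | i < 4].
suff [P ->] : exists P, \sum_(au <- s) au.1 *: au.2
    = P \mPo [tuple 'X_[tnth (lead_gens #|` W|) i] | i < 4].
  exists P; split=> // i; rewrite tnth_mktuple.
  exists (tnth (gens W) i), (tnth (lead_gens #|` W|) i).
  by split; [apply: mem_tnth | apply: is_lead_mon_gens | ].
pose g := [tuple 'X_[tnth (lead_gens #|` W|) i] | i < 4] : 4.-tuple {mpoly F[3]}.
rewrite -/g big_seq; apply: (big_ind (fun u => exists P, u = P \mPo g))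
  => [|_ _ [P ->] [Q ->]|[a u] /ls /=].
- by exists 0; rewrite comp_mpoly0.
- by exists (P + Q); rewrite comp_mpolyD.
case=> f1 [m [/inv_gens[P ->] lm ->]].
(* The lead monomial of an invariant comes from a term of its normal form, so it is a monomial in
   the lead monomials of the generators. *)
have [Q [N [defP nfN]]] := normal_form W P.
rewrite defP rel_gens // in lm.
have nzN : N != 0.
  by apply: contraPneq lm => ->; rewrite comp_mpoly0 => -[]; rewrite msupp0.
have [m' _ /(is_lead_mon_uniq lm) ->] := normal_form_lead W_odd nfN nzN.
by exists (a *: 'X_[m']); rewrite comp_mpolyZ mpolyX_mnm_eval.
Qed.
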